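(* Let $n\ge1$, let $\sigma\in\mathfrak{S}_n$, and let $\Psi=(\psi_{FV}^0)^{-1}\circ\psi\circ\psi_{FV}:\mathfrak{S}_n\to\mathfrak{S}_n$. Then $\sigma$ and $\Psi(\sigma)$ belong to the same co-sylvester class, i.e. $\mathrm{BST}(\sigma)=\mathrm{BST}(\Psi(\sigma))$.
   Context: $\mathfrak{S}_n$ is the set of permutations $\sigma=\sigma_1\cdots\sigma_n$ of $\{1,\dots,n\}$. For a value $k$, $\mathrm{tot}_k(\sigma)$ is the number of pairs $(i,j)$ with $i+1<j$, $\sigma_j=k$ and $\sigma_{i+1}<\sigma_j<\sigma_i$. Weighted Dyck paths. A Dyck path of size $n$ is a sequence $D=D_1\cdots D_{2n}$ of $n$ up steps $/$ and $n$ down steps $\backslash$ never going below the horizontal axis. A weighted Dyck path of size $n$ is a pair $(D,w)$ with $D$ a Dyck path of size $n$ and $w=(w_1,\dots,w_n)$ a vector of nonnegative integers with $w_i\le (h_i-1)/2$ for all $i$, where $h_i$ is the height of the starting point of step $D_{2i}$. The bijection $\psi_{FV}$ (permutations of size $n$ to weighted Dyck paths of size $n$): with the convention $\sigma_0=0$, $\sigma_{n+1}=n+1$, $\psi_{FV}(\sigma)=(D,w)$ where for each $j\in\{1,\dots,n\}$ and $k=\sigma_j$: $D_{2k-1}=/$ if $\sigma_j<\sigma_{j+1}$ and $D_{2k-1}=\backslash$ otherwise; $D_{2k}=\backslash$ if $\sigma_{j-1}<\sigma_j$ and $D_{2k}=/$ otherwise; $w_k=\mathrm{tot}_k(\sigma)$.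 The bijection $\psi_{FV}^0$ (permutations of size $n$ to weighted Dyck paths of size $n$): with the convention $\sigma_0=\sigma_{n+1}=0$, apply the same rules to the values $1,\dots,n-1$ only, then add an up step at the beginning and a down step at the end of the path, and a $0$ at the end of the weight. Explicitly, $\psi^0_{FV}(\sigma)=(D,w)$ with $D_1=/$, $D_{2n}=\backslash$, $w_n=0$, and for each $k=\sigma_j\in\{1,\dots,n-1\}$: $D_{2k}=/$ if $\sigma_j<\sigma_{j+1}$ and $\backslash$ otherwise; $D_{2k+1}=\backslash$ if $\sigma_{j-1}<\sigma_j$ and $/$ otherwise; $w_k=\mathrm{tot}_k(\sigma)$. The involution $\psi$ on weighted Dyck paths of size $n$: for each $i\in\{1,\dots,n-1\}$, if the steps at positions $2i,2i+1$ are $/\backslash$ they are replaced by $\backslash/$ and vice versa (otherwise they are unchanged); the weight is unchanged. Binary search trees. A binary search tree is a labeled binary tree such that for each node all values in its left (resp. right) subtree are smaller (resp. greater) than the value at the node. $\mathrm{BST}(\sigma)$ is the binary search tree built recursively: start with $I=\{1,\dots,n\}$; the root for the interval $I$ is the first (leftmost) value of $\sigma$ lying in $I$, say $k$; its left subtree is obtained by applying the procedure to the elements of $I$ smaller than $k$ and its right subtree by applying it to those greater than $k$ (an empty interval gives an empty tree). Two permutations belong to the same co-sylvester class if they have the same $\mathrm{BST}$. *)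

(* Defs.v *)
From HB Require Import structures.
From mathcomp Require Import all_boot all_order all_algebra all_fingroup.
From mathcomp Require Import zify.

Set Implicit Arguments.
Unset Strict Implicit.
Unset Printing Implicit Defensive.

Import Order.TTheory GRing.Theory Num.Theory.

(* A permutation sigma : 'S_n is read as the word sigma_1 ... sigma_n on the
   values 1, ..., n, whereas 'S_n acts on {0, ..., n-1}: hence the .+1. *)
Definition word n (sigma : 'S_n) : seq nat :=
  [seq (sigma i).+1 | i <- enum 'I_n].

(* [nth 0 (letters e sigma) j] is sigma_j for 0 <= j <= n+1, with the
   conventions sigma_0 = 0 and sigma_{n+1} = e. *)
Definition letters n (e : nat) (sigma : 'S_n) : seq nat :=
  0 :: rcons (word sigma) e.

(* Positions are counted from 0 in [word sigma]. *)
Definition tot n (k : nat) (sigma : 'S_n) : nat :=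
  #|[set p : 'I_n * 'I_n |
      let s_ := nth 0 (word sigma) in
      [&& p.1.+1 < p.2, s_ p.2 == k, s_ p.1.+1 < s_ p.2 & s_ p.2 < s_ p.1]]|.

(* sigma_j < sigma_{j+1}, where k = sigma_j and sigma_{n+1} = e *)
Definition ascR n (e : nat) (sigma : 'S_n) (k : nat) : bool :=
  let s_ := nth 0 (letters e sigma) in
  let j := index k (letters e sigma) in s_ j < s_ j.+1.

(* sigma_{j-1} < sigma_j, where k = sigma_j and sigma_0 = 0 *)
Definition ascL n (e : nat) (sigma : 'S_n) (k : nat) : bool :=
  let s_ := nth 0 (letters e sigma) in
  let j := index k (letters e sigma) in s_ j.-1 < s_ j.

(* In a sequence of steps, [true] is an up step and [false] a down step; the
   entries D_1, D_2, ... and w_1, w_2, ... are numbered from 1. *)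
Definition entry (T : Type) (x0 : T) (s : seq T) (k : nat) : T := nth x0 s k.-1.

(* height after the first m steps *)
Definition height (D : seq bool) (m : nat) : int :=
  ((count_mem true (take m D))%:Z - (count_mem false (take m D))%:Z)%R.

Definition is_dyck (n : nat) (D : seq bool) : bool :=
  [&& count_mem true D == n, count_mem false D == n &
      [forall m : 'I_(n.*2).+1, (0 <= height D m)%R]].

(* The starting point of D_{2i} is reached after 2i-1 steps. *)
Definition is_weight (n : nat) (D : seq bool) (w : seq nat) : bool :=
  [forall i : 'I_n.+1, (0 < i) ==>
     (2%:Z * (entry 0%N w i)%:Z <= height D (i.*2).-1 - 1)%R].

Definition is_wdyck n (p : n.*2.-tuple bool * n.-tuple nat) : bool :=
  is_dyck n p.1 && is_weight n p.1 p.2.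

Definition wdyck (n : nat) : Type :=
  {p : n.*2.-tuple bool * n.-tuple nat | is_wdyck p}.

Definition steps_of (n : nat) (f : nat -> bool) : n.*2.-tuple bool :=
  [tuple of [seq f p | p <- iota 1 n.*2]].

Definition weights_of (n : nat) (f : nat -> nat) : n.-tuple nat :=
  [tuple of [seq f k | k <- iota 1 n]].

Definition FV_step n (sigma : 'S_n) (p : nat) : bool :=
  if odd p then ascR n.+1 sigma (p.+1)./2 else ~~ ascL n.+1 sigma p./2.

Definition FV_raw n (sigma : 'S_n) : n.*2.-tuple bool * n.-tuple nat :=
  (steps_of n (FV_step sigma), weights_of n (fun k => tot k sigma)).

Definition FV0_step n (sigma : 'S_n) (p : nat) : bool :=
  if p == 1 then true else if p == n.*2 then false
  else if odd p then ~~ ascL 0 sigma p./2 else ascR 0 sigma p./2.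

Definition FV0_raw n (sigma : 'S_n) : n.*2.-tuple bool * n.-tuple nat :=
  (steps_of n (FV0_step sigma),
   weights_of n (fun k => if k == n then 0 else tot k sigma)).

(* The position p with 1 < p < 2n lies in the pair (2i, 2i+1) for i = p./2. *)
Definition psi_step (n : nat) (D : seq bool) (p : nat) : bool :=
  let i := p./2 in
  if (1 < p < n.*2) && (entry false D i.*2 != entry false D (i.*2).+1)
  then ~~ entry false D p else entry false D p.

Definition psi_raw n (p : n.*2.-tuple bool * n.-tuple nat) :
  n.*2.-tuple bool * n.-tuple nat := (steps_of n (psi_step n p.1), p.2).

Inductive bintree : Type :=
  | Leaf : bintree
  | Node : bintree -> nat -> bintree -> bintree.

(* [fuel] bounds the size of the interval I, which decreases at each call. *)
Fixpoint bst_rec (fuel : nat) (s I : seq nat) : bintree :=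
  if fuel is fuel'.+1 then
    if [seq x <- s | x \in I] is k :: _ then
      Node (bst_rec fuel' s [seq x <- I | x < k]) k
           (bst_rec fuel' s [seq x <- I | k < x])
    else Leaf
  else Leaf.

Definition BST n (sigma : 'S_n) : bintree :=
  bst_rec n (word sigma) (iota 1 n).

(* The lemmas below show that FV_raw, FV0_raw and psi_raw take values in
   weighted Dyck paths, and that FV0_raw is a bijection onto them. *)

(* [runs k s] lists the maximal factors of s all of whose letters are < k. *)
Definition cons_ne (y : seq nat) (C : seq (seq nat)) : seq (seq nat) :=
  if y is [::] then C else y :: C.

Fixpoint split_runs (k : nat) (s : seq nat) : seq nat * seq (seq nat) :=
  if s is x :: s' then
    let: (y, C) := split_runs k s' in
    if x < k then (x :: y, C) else ([::], cons_ne y C)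
  else ([::], [::]).

Definition runs (k : nat) (s : seq nat) : seq (seq nat) :=
  cons_ne (split_runs k s).1 (split_runs k s).2.

(* number of descents of s passing strictly above and below k *)
Definition crossing (k : nat) (s : seq nat) : nat :=
  \sum_(i < (size s).-1) (nth 0 s i.+1 < k < nth 0 s i).

Lemma cons_ne_cat y C E : cons_ne y (C ++ E) = cons_ne y C ++ E.
Proof. by case: y. Qed.

Lemma size_cons_ne y C : size (cons_ne y C) = (y != [::]) + size C.
Proof. by case: y. Qed.

Lemma runs_cons k x s : runs k (x :: s) =
  if x < k then (x :: (split_runs k s).1) :: (split_runs k s).2 else runs k s.
Proof. by rewrite /runs /=; case: split_runs => y C; case: ifP. Qed.

Lemma split_cat k u x v : k <= x ->
  split_runs k (u ++ x :: v) = ((split_runs k u).1, (split_runs k u).2 ++ runs k v).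
Proof.
move=> kx; elim: u => [|a u IHu] /=.
  by rewrite /runs; case: split_runs => y C; rewrite ltnNge kx.
by rewrite IHu; case: split_runs => y C /=; case: ifP => // _; rewrite cons_ne_cat.
Qed.

Lemma runs_cat k u x v : k <= x -> runs k (u ++ x :: v) = runs k u ++ runs k v.
Proof. by move=> kx; rewrite {1}/runs split_cat //= cons_ne_cat. Qed.

Lemma split_all k s : all (fun x => x < k) s -> split_runs k s = (s, [::]).
Proof. by elim: s => //= x s IHs /andP[xk /IHs ->]; rewrite xk. Qed.

Lemma runs_all k s : all (fun x => x < k) s -> runs k s = cons_ne s [::].
Proof. by move=> /split_all; rewrite /runs => ->. Qed.

Lemma runs_none k s : all (fun x => k <= x) s -> runs k s = [::].
Proof. by elim: s => //= x s IHs /andP[kx /IHs]; rewrite runs_cons ltnNge kx. Qed.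

Lemma runs_gt0 k s : has (fun x => x < k) s -> 0 < size (runs k s).
Proof.
elim: s => //= x s IHs; rewrite runs_cons.
by case: ifP => //= _ /IHs.
Qed.

Lemma split_succ k s : k \notin s -> split_runs k.+1 s = split_runs k s.
Proof.
elim: s => //= x s IHs; rewrite in_cons negb_or => /andP[kx /IHs ->].
by case: split_runs => y C; rewrite ltnS leq_eqVlt eq_sym (negPf kx).
Qed.

Lemma split_nil k v : k \notin v ->
  ((split_runs k v).1 != [::]) = (head k v < k).
Proof.
case: v => /= [|x v _]; first by rewrite ltnn.
by case: split_runs => y C; case: ifP.
Qed.

Lemma split_allcat k u v : k \notin v -> all (fun x => x < k) u ->
  split_runs k.+1 (u ++ k :: v) =
    (u ++ k :: (split_runs k v).1, (split_runs k v).2).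
Proof.
move=> kv; elim: u => [_|x u IHu] /=.
  by rewrite split_succ //; case: split_runs => y C; rewrite ltnSn.
by move=> /andP[xk /IHu ->]; rewrite ltnS ltnW.
Qed.

Lemma last_big k u : all (fun x => x < k) u \/
  exists u1 b u2, [/\ u = u1 ++ b :: u2, k <= b & all (fun x => x < k) u2].
Proof.
elim/last_ind: u => [|u a]; first by left.
case: (ltnP a k) => [ak|ka _]; last by right; exists u, a, [::]; rewrite cats1.
case=> [uk|[u1 [b [u2 [-> kb u2k]]]]]; first by left; rewrite all_rcons ak.
by right; exists u1, b, (rcons u2 a); rewrite rcons_cat all_rcons ak.
Qed.

Lemma last_all k u : all (fun x => x < k) u -> (u != [::]) = (last k u < k).
Proof.
case/lastP: u => [|u a]; first by rewrite /= ltnn.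
by rewrite all_rcons last_rcons => /andP[-> _]; case: u.
Qed.

Lemma runs_split k u v : k \notin u -> k \notin v ->
  exists A x, [/\ runs k u = A ++ cons_ne x [::],
      runs k.+1 (u ++ k :: v) =
        A ++ (x ++ k :: (split_runs k v).1) :: (split_runs k v).2 &
      (x != [::]) = (last k u < k)].
Proof.
move=> ku kv; case: (last_big k u) => [uk|[u1 [b [u2 [def_u kb u2k]]]]].
  exists [::], u; rewrite runs_all // /runs split_allcat // (last_all uk) /=.
  by split=> //; case: (u).
have {ku} : k \notin u1 /\ k < b.
  move: ku; rewrite def_u mem_cat in_cons !negb_or ltn_neqAle kb andbT.
  by case/and3P.
case=> ku1 kltb; exists (runs k u1), u2; rewrite def_u runs_cat // (runs_all u2k).
have r1 : runs k.+1 u1 = runs k u1 by rewrite /runs split_succ.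
have r2 : runs k.+1 (u2 ++ k :: v) =
    (u2 ++ k :: (split_runs k v).1) :: (split_runs k v).2.
  by rewrite /runs split_allcat //; case: (u2).
rewrite -catA /= runs_cat // r1 r2 last_cat /= (last_all u2k); split=> //.
case/lastP: u2 u2k {def_u r2} => [|u2 a] _; last by rewrite !last_rcons.
by rewrite /= ltnn ltnNge kb.
Qed.

Lemma crossing_cons k a b s :
  crossing k (a :: b :: s) = (b < k < a) + crossing k (b :: s).
Proof. by rewrite /crossing /= big_ord_recl. Qed.

Lemma size_runs k a s : k \notin a :: s ->
  size (runs k (a :: s)) = crossing k (a :: s) + (a < k).
Proof.
elim: s a => [|b s IHs] a.
  by rewrite runs_cons /crossing big_ord0 /=; case: ifP.
rewrite in_cons negb_or eq_sym neq_ltn => /andP[ak kbs].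
have := IHs _ kbs; rewrite crossing_cons runs_cons.
move: kbs; rewrite in_cons negb_or eq_sym neq_ltn => /andP[bk _].
rewrite !runs_cons /= /runs; case: split_runs => y C /=.
by case: (ltnP b k) => /=; case: (ltnP a k) => /=; lia.
Qed.

Lemma size_wordE n (sigma : 'S_n) : size (word sigma) = n.
Proof. by rewrite size_map size_enum_ord. Qed.

Lemma nth_word n (sigma : 'S_n) (i : 'I_n) : nth 0 (word sigma) i = (sigma i).+1.
Proof. by rewrite (nth_map i) ?size_enum_ord // nth_ord_enum. Qed.

Lemma word_uniq n (sigma : 'S_n) : uniq (word sigma).
Proof. by rewrite map_inj_uniq ?enum_uniq // => i j [] /ord_inj /perm_inj. Qed.

Lemma mem_word n (sigma : 'S_n) k : (k \in word sigma) = (0 < k <= n).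
Proof.
apply/mapP/idP => [[i _ ->]|]; first by rewrite /= ltn_ord.
case: k => //= k kn; exists ((sigma^-1)%g (Ordinal kn)); first by rewrite mem_enum.
by rewrite permKV.
Qed.

Lemma word_inj n : injective (@word n).
Proof.
move=> s t st; apply/permP => i; apply/ord_inj/succn_inj.
by rewrite -!nth_word st.
Qed.

Lemma word_split n (sigma : 'S_n) k : 0 < k <= n -> exists u v,
  [/\ word sigma = u ++ k :: v, k \notin u & k \notin v].
Proof.
rewrite -(mem_word sigma) => /splitPr H.
case: H (word_uniq sigma) => u v; rewrite cat_uniq /= negb_or.
by move=> /and3P[_ /andP[ku _] /andP[kv _]]; exists u, v.
Qed.

Section Split.
Variables (n : nat) (sigma : 'S_n) (k : nat) (u v : seq nat) (e : nat).
Hypotheses (k_gt0 : 0 < k) (def_w : word sigma = u ++ k :: v).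
Hypotheses (ku : k \notin u) (kv : k \notin v) (ke : k != e).

Lemma lettersE : letters e sigma = (0 :: u) ++ k :: rcons v e.
Proof. by rewrite /letters def_w rcons_cat. Qed.

Lemma k_notin_0u : k \notin 0 :: u.
Proof. by rewrite in_cons negb_or ku -lt0n k_gt0. Qed.

Lemma k_notin_ve : k \notin rcons v e.
Proof. by rewrite mem_rcons in_cons negb_or ke. Qed.

Lemma index_letters : index k (letters e sigma) = (size u).+1.
Proof. by rewrite lettersE index_cat (negPf k_notin_0u) /= eqxx addn0. Qed.

Lemma ascLE : ascL e sigma k = (last 0 u < k).
Proof.
rewrite /ascL index_letters lettersE !nth_cat /= ltnSn ltnn subnn /=.
by rewrite -[size u]/(size (0 :: u)).-1 nth_last.
Qed.

Lemma ascRE : ascR e sigma k = (k < head k (rcons v e)).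
Proof.
rewrite /ascR index_letters lettersE !nth_cat /= ltnn subnn.
have -> : ((size u).+2 < (size u).+1) = false by lia.
by rewrite subSn // subnn /=; case: (v).
Qed.

Lemma not_ascR : ~~ ascR e sigma k = (head k (rcons v e) < k).
Proof.
rewrite ascRE -leqNgt leq_eqVlt; case: eqP => //= hk.
move: k_notin_ve; rewrite -{1}hk; case: (v) => /= [|a s]; by rewrite !inE eqxx.
Qed.

Lemma totE : tot k sigma = crossing k (0 :: u).
Proof.
have szn := size_wordE sigma; rewrite def_w size_cat /= addnS in szn.
have un : size u < n by lia.
have -> : crossing k (0 :: u) = crossing k u.
  case: (u) => [|a s]; last by rewrite crossing_cons andbF.
  by rewrite /crossing !big_ord0.
pose P i := (i.+1 < size u) && (nth 0 u i.+1 < k < nth 0 u i).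
pose j0 := Ordinal un.
have wk : nth 0 (word sigma) (size u) = k by rewrite def_w nth_cat ltnn subnn.
have nthu i : i < size u -> nth 0 (word sigma) i = nth 0 u i.
  by move=> iu; rewrite def_w nth_cat iu.
have -> : tot k sigma = #|[set (i, j0) | i in [set i : 'I_n | P i]]|.
  apply: eq_card => -[i j]; rewrite !inE /=.
  apply/idP/imsetP => [/and4P[ij /eqP wj h1 h2]|[i' ]].
    have ej : j = j0.
      apply/ord_inj/eqP; rewrite -(@nth_uniq _ 0 (word sigma)) ?size_wordE //.
      - by rewrite wj wk.
      - exact: word_uniq.
    exists i; last by rewrite ej.
    move: ij h1 h2; rewrite wj ej /= => ij.
    rewrite !nthu //; last exact: ltnW.
    by rewrite inE /P ij => -> ->.
  rewrite inE /P => /andP[iu h] [-> ->] /=.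
  by rewrite iu wk eqxx /= !nthu // ltnW.
rewrite card_imset; last by move=> i j [].
rewrite -sum1_card /crossing.
rewrite (big_ord_widen n (fun i => (nth 0 u i.+1 < k < nth 0 u i) : nat)); last lia.
rewrite big_mkcond [RHS]big_mkcond; apply: eq_bigr => i _; rewrite inE /P.
have -> : (i.+1 < size u) = (i < (size u).-1) by case: (size u).
by case: (i < _) => //=; case: (_ && _).
Qed.

Lemma letters_split : exists A x y C,
  [/\ runs k (letters e sigma) = A ++ cons_ne x (cons_ne y C),
      runs k.+1 (letters e sigma) = A ++ (x ++ k :: y) :: C,
      (x != [::]) = ascL e sigma k,
      (y != [::]) = ~~ ascR e sigma k &
      size A + (x != [::]) = (tot k sigma).+1 /\
      (e = 0 -> 0 < (y != [::]) + size C)].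
Proof.
have [A [x [H1 H2 H3]]] := runs_split k_notin_0u k_notin_ve.
exists A, x, (split_runs k (rcons v e)).1, (split_runs k (rcons v e)).2.
rewrite lettersE H2 H3 runs_cat // H1 -catA ascLE not_ascR split_nil ?k_notin_ve //.
split=> //; first by case: (x) => //= *; rewrite /runs.
split.
  rewrite -/(last k (0 :: u)) in H3 *.
  have := size_runs k_notin_0u; rewrite H1 size_cat size_cons_ne addn0 H3 totE.
  by rewrite k_gt0 addn1.
move=> e0; rewrite -split_nil ?k_notin_ve // -size_cons_ne -/(runs _ _).
apply: runs_gt0; rewrite -cats1 has_cat /= e0 k_gt0.
by rewrite orbT.
Qed.
End Split.

Lemma letters_step n (sigma : 'S_n) k e : 0 < k <= n -> k != e ->
  let L := letters e sigma in
  [/\ size (runs k.+1 L) + ascL e sigma k + ~~ ascR e sigma k = (size (runs k L)).+1,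
      tot k sigma + 1 + ~~ ascR e sigma k <= size (runs k L) &
      e = 0 -> tot k sigma + 2 <= size (runs k L)].
Proof.
move=> kn ke /=; have [u [v [def_w ku kv]]] := word_split sigma kn.
have k0 : 0 < k by case/andP: kn.
have [A [x [y [C [-> -> xl yr [szA szC]]]]]] := letters_split k0 def_w ku kv ke.
rewrite !size_cat /= !size_cons_ne -xl -yr; split; [lia|lia|].
by move/szC; lia.
Qed.

Lemma word_gt0 n (sigma : 'S_n) : all (fun x => 0 < x) (word sigma).
Proof. by apply/allP => x; rewrite mem_word => /andP[]. Qed.

Lemma word_le n (sigma : 'S_n) : all (fun x => x <= n) (word sigma).
Proof. by apply/allP => x; rewrite mem_word => /andP[]. Qed.

Lemma runs1_rcons0 w : all (fun x => 0 < x) w -> runs 1 (rcons w 0) = [:: [:: 0]].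
Proof. by elim: w => //= -[|x] w IHw //= /IHw; rewrite runs_cons. Qed.

Lemma runs1_letters0 n (sigma : 'S_n) : 0 < n ->
  runs 1 (letters 0 sigma) = [:: [:: 0]; [:: 0]].
Proof.
move=> n0; have := size_wordE sigma; have := word_gt0 sigma; rewrite /letters.
case: (word sigma) => [_ /= n0'|a w /= /andP[a0 w0] _]; first by rewrite -n0' in n0.
by rewrite (@runs_cat 1 [:: 0]) // runs1_rcons0.
Qed.

Lemma runs1_letters n (sigma : 'S_n) e : 0 < e ->
  runs 1 (letters e sigma) = [:: [:: 0]].
Proof.
move=> e0; have := word_gt0 sigma; rewrite /letters.
case: (word sigma) => [|a w] /= => [_|/andP[a0 w0]].
  by rewrite (@runs_cat 1 [:: 0]).
by rewrite (@runs_cat 1 [:: 0]) // (@runs_none _ (rcons w e)) // all_rcons e0.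
Qed.

Lemma runs_top n (sigma : 'S_n) :
  size (runs n.+1 (letters n.+1 sigma)) = 1.
Proof.
rewrite /letters -cats1 -cat_cons runs_cat // runs_all //=.
by apply: sub_all (word_le sigma) => x.
Qed.

Lemma runs_top0 n (sigma : 'S_n) :
  runs n.+1 (letters 0 sigma) = [:: letters 0 sigma].
Proof.
rewrite runs_all //= all_rcons /=.
by apply: sub_all (word_le sigma) => x.
Qed.

Lemma last_value n (sigma : 'S_n) : 0 < n ->
  [/\ ascL 0 sigma n, ~~ ascR 0 sigma n & tot n sigma = 0].
Proof.
move=> n0; have nn : 0 < n <= n by rewrite n0 leqnn.
have [u [v [def_w nu nv]]] := word_split sigma nn.
have nN0 : n != 0 by rewrite -lt0n.
have := word_le sigma; rewrite def_w all_cat /= leqnn /= => /andP[un vn].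
have u0n : all (fun x => x < n) (0 :: u).
  apply/allP => x xu; rewrite ltn_neqAle; apply/andP; split.
    by apply: contraTneq xu => ->; rewrite k_notin_0u.
  by move: xu; rewrite in_cons => /predU1P[-> //|/(allP un)].
split.
- by rewrite (ascLE 0 n0 def_w nu); apply: (allP u0n); rewrite mem_last.
- rewrite (not_ascR n0 def_w nu nv nN0); case: v nv vn {def_w} => //= x v.
  by rewrite in_cons negb_or ltn_neqAle eq_sym => /andP[-> _] /andP[].
rewrite (totE n0 def_w nu nv nN0) /crossing big1 // => i _.
have := allP u0n (nth 0 (0 :: u) i); rewrite mem_nth; last first.
  by case: i => /= i; lia.
by move=> /(_ isT); case: (ltnP n) => //; [lia|rewrite andbF].
Qed.

Lemma runs_last n (sigma : 'S_n) : 0 < n -> size (runs n (letters 0 sigma)) = 2.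
Proof.
move=> n0; have nn : 0 < n <= n by rewrite n0 leqnn.
have nN0 : n != 0 by rewrite -lt0n.
have [] := letters_step sigma nn nN0; have [-> -> _] := last_value sigma n0.
by rewrite runs_top0 /=; lia.
Qed.

Lemma height_succ D m : m < size D ->
  height D m.+1 = (height D m + (if nth false D m then 1 else - 1))%R.
Proof.
move=> mD; rewrite /height (take_nth false) // -cats1 !count_cat /=.
by case: nth => /=; lia.
Qed.

Lemma height0 D : height D 0 = 0%R.
Proof. by rewrite /height take0. Qed.

Lemma nth_steps n f i : i < n.*2 -> nth false (steps_of n f) i = f i.+1.
Proof. by move=> ilt; rewrite /= (nth_map 0) ?size_iota // nth_iota. Qed.

Lemma nth_weights n f i : i < n -> nth 0 (weights_of n f) i = f i.+1.
Proof. by move=> ilt; rewrite /= (nth_map 0) ?size_iota // nth_iota. Qed.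

Lemma is_dyckP n (D : n.*2.-tuple bool) :
  (forall m, m <= n.*2 -> (0 <= height D m)%R) -> height D n.*2 = 0%R -> is_dyck n D.
Proof.
move=> h0 hn; have szD := size_tuple D.
have : count_mem true D + count_mem false D = n.*2.
  rewrite -[RHS]szD -(count_predC (pred1 true) D); congr (_ + _).
  by apply: eq_count; case.
move: hn; rewrite /height take_oversize ?szD // => hn hc.
apply/and3P; split; [apply/eqP; lia|apply/eqP; lia|].
by apply/forallP => m; apply: h0; rewrite -ltnS ltn_ord.
Qed.

Lemma parity_case (m : nat) : exists k, m = k.*2 \/ m = k.*2.+1.
Proof. by exists m./2; have := odd_double_half m; case: odd => /=; lia. Qed.

Lemma FV_height n (sigma : 'S_n) k : k <= n ->
  height (FV_raw sigma).1 k.*2 =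
    (2%:Z * (size (runs k.+1 (letters n.+1 sigma)))%:Z - 2)%R.
Proof.
elim: k => [|k IHk] kn; first by rewrite height0 runs1_letters.
have kn' : 0 < k.+1 <= n by [].
have kN : k.+1 != n.+1 by lia.
have [st _ _] := letters_step sigma kn' kN.
have szD := size_tuple (FV_raw sigma).1.
rewrite doubleS !height_succ; try by rewrite szD; lia.
rewrite IHk 1?ltnW // !nth_steps; try lia.
have -> : FV_step sigma k.*2.+1 = ascR n.+1 sigma k.+1.
  by rewrite /FV_step /= odd_double /= doubleK.
have -> : FV_step sigma k.*2.+2 = ~~ ascL n.+1 sigma k.+1.
  by rewrite /FV_step /= odd_double /= doubleK.
by case: ascR st; case: ascL => /=; lia.
Qed.

Lemma FV_height_odd n (sigma : 'S_n) k : k < n ->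
  height (FV_raw sigma).1 k.*2.+1 =
    (2%:Z * (size (runs k.+1 (letters n.+1 sigma)))%:Z - 2
     + (if ascR n.+1 sigma k.+1 then 1 else - 1))%R.
Proof.
move=> kn; have szD := size_tuple (FV_raw sigma).1.
rewrite height_succ; last by rewrite szD; lia.
rewrite FV_height 1?ltnW // nth_steps; last lia.
by rewrite /FV_step /= odd_double /= doubleK.
Qed.

Lemma is_weightP n D (w : seq nat) :
  (forall i, i < n -> (2%:Z * (nth 0%N w i)%:Z <= height D i.*2.+1 - 1)%R) ->
  is_weight n D w.
Proof.
move=> H; apply/forallP => -[[|i] lti] //.
by rewrite /entry /= ?doubleS; apply: H.
Qed.

Lemma FV_wdyck n (sigma : 'S_n) : is_wdyck (FV_raw sigma).
Proof.
have st k : k < n -> tot k.+1 sigma + 1 + ~~ ascR n.+1 sigma k.+1 <=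
    size (runs k.+1 (letters n.+1 sigma)).
  move=> kn; have kN : k.+1 != n.+1 by lia.
  by have [] := @letters_step n sigma k.+1 n.+1 kn kN.
apply/andP; split.
  apply: is_dyckP => [m mn|]; last by rewrite FV_height // runs_top.
  have [k [Dm|Dm]] := parity_case m; rewrite Dm in mn *.
    rewrite FV_height; last lia.
    have [kn|nk] := ltnP k n; first by have := st _ kn; lia.
    have -> : k = n by lia.
    by rewrite runs_top.
  have kn : k < n by lia.
  by rewrite FV_height_odd //; have := st _ kn; case: ascR => /=; lia.
apply: is_weightP => i lti.
rewrite FV_height_odd // nth_weights //.
by have := st _ lti; case: ascR => /=; lia.
Qed.

Lemma FV0_step_even n (sigma : 'S_n) k : 0 < k < n ->
  FV0_step sigma k.*2 = ascR 0 sigma k.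
Proof.
move=> kn; rewrite /FV0_step odd_double doubleK.
by case: eqP; [lia|case: eqP; [lia|]].
Qed.

Lemma FV0_step_odd n (sigma : 'S_n) k : 0 < k < n ->
  FV0_step sigma k.*2.+1 = ~~ ascL 0 sigma k.
Proof.
move=> kn; rewrite /FV0_step /= odd_double uphalf_double.
by case: eqP; [lia|case: eqP; [lia|]].
Qed.

Lemma FV0_height n (sigma : 'S_n) k : k < n ->
  height (FV0_raw sigma).1 k.*2.+1 =
    (2%:Z * (size (runs k.+1 (letters 0 sigma)))%:Z - 3)%R.
Proof.
have szD := size_tuple (FV0_raw sigma).1.
elim: k => [|k IHk] kn.
  by rewrite height_succ ?szD ?height0 ?nth_steps ?runs1_letters0 //; lia.
have kn' : 0 < k.+1 <= n by lia.
have [st _ _] := @letters_step n sigma k.+1 0 kn' isT.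
rewrite doubleS !(@height_succ _ _.+1); try by rewrite szD; lia.
rewrite IHk 1?ltnW // !nth_steps; try lia.
rewrite -doubleS FV0_step_even // FV0_step_odd //.
by case: ascR st; case: ascL => /=; lia.
Qed.

Lemma FV0_wdyck n (sigma : 'S_n) : is_wdyck (FV0_raw sigma).
Proof.
case: (posnP n) => [n0|n0].
  apply/andP; split; last by apply: is_weightP => i; rewrite {1}n0.
  have nil : tval (FV0_raw sigma).1 = [::] by apply: size0nil; rewrite size_tuple n0.
  by apply: is_dyckP => [m _|]; rewrite nil /height.
have szD := size_tuple (FV0_raw sigma).1.
have st k : k < n -> tot k.+1 sigma + 2 <= size (runs k.+1 (letters 0 sigma)).
  by move=> kn; have [_ _ ->] := @letters_step n sigma k.+1 0 kn isT.
have hn : height (FV0_raw sigma).1 n.*2 = 0%R.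
  case: (n) n0 (sigma) szD => // m _ s szD.
  rewrite [X in height _ X]doubleS height_succ; last by rewrite szD; lia.
  rewrite FV0_height // runs_last // nth_steps; last lia.
  by rewrite /FV0_step -doubleS eqxx; case: eqP => //; lia.
have hodd k : k < n -> (1 <= height (FV0_raw sigma).1 k.*2.+1)%R.
  by move=> kn; rewrite FV0_height //; have := st _ kn; lia.
apply/andP; split.
  apply: is_dyckP => // m mn.
  have [k [Dm|Dm]] := parity_case m; rewrite Dm in mn *; last first.
    by apply: le_trans (hodd k _); lia.
  have [->|kn] := eqVneq k n; first by rewrite hn.
  case: k {Dm} kn mn => [|k] kn mn; first by rewrite height0.
  rewrite doubleS height_succ; last by rewrite szD; lia.
  by have := hodd k; case: nth => /=; lia.
apply: is_weightP => i lti.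
rewrite FV0_height // nth_weights //.
by have := st _ lti; case: eqP => _; lia.
Qed.

Lemma wdyckP n (p : n.*2.-tuple bool * n.-tuple nat) : is_wdyck p ->
  [/\ forall m, m <= n.*2 -> (0 <= height p.1 m)%R, height p.1 n.*2 = 0%R &
   forall i, i < n -> (2%:Z * (nth 0%N p.2 i)%:Z <= height p.1 i.*2.+1 - 1)%R].
Proof.
move=> /andP[/and3P[/eqP ct /eqP cf /forallP hD] /forallP hw]; split.
- by move=> m mn; have := hD (Ordinal (mn : m < n.*2.+1)).
- by rewrite /height take_oversize ?size_tuple // ct cf subrr.
move=> i lti; exact: (implyP (hw (Ordinal (lti : i.+1 < n.+1)))).
Qed.

Lemma psi_wdyck n (p : n.*2.-tuple bool * n.-tuple nat) :
  is_wdyck p -> is_wdyck (psi_raw p).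
Proof.
move=> /wdyckP[hD hn hw].
have szD := size_tuple p.1; have szE := size_tuple (psi_raw p).1.
have hodd k : k < n -> height (psi_raw p).1 k.*2.+1 = height p.1 k.*2.+1.
  elim: k => [|k IHk] kn.
    rewrite !height_succ ?szD ?szE ?height0 ?nth_steps //; lia.
  rewrite doubleS !(@height_succ _ _.+1); try by rewrite ?szD ?szE; lia.
  rewrite IHk 1?ltnW // !nth_steps; try lia.
  rewrite /psi_step /entry -doubleS.
  have -> : (1 < k.+1.*2 < n.*2) = true by lia.
  have -> : (1 < k.+1.*2.+1 < n.*2) = true by lia.
  have -> : k.+1.*2.+1./2 = k.+1 by rewrite /= uphalf_double.
  rewrite doubleK doubleS /=.
  by case: (nth _ _ k.*2.+1); case: nth => /=; lia.
have hn' : height (psi_raw p).1 n.*2 = 0%R.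
  case: (posnP n) => [n0|n0]; first by rewrite [X in height _ X](_ : _ = 0) ?height0 // n0.
  rewrite -hn; have Dn : n.*2 = n.-1.*2.+2 by lia.
  rewrite [X in height _ X]Dn [X in _ = height _ X]Dn.
  rewrite (@height_succ (psi_raw p).1) ?szE; last lia.
  rewrite (@height_succ p.1) ?szD; last lia.
  rewrite hodd ?nth_steps; try lia.
  rewrite /psi_step; have -> : (n.-1.*2.+2 < n.*2) = false by lia.
  by rewrite andbF.
apply/andP; split; last by apply: is_weightP => i lti; rewrite hodd // hw.
apply: is_dyckP => // m mn.
have [k [Dm|Dm]] := parity_case m; rewrite Dm in mn *; last first.
  by rewrite hodd ?hD //; lia.
have [->|kn] := eqVneq k n; first by rewrite hn'.
case: k {Dm} kn mn => [|k] kn mn; first by rewrite height0.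
have kn' : k < n by lia.
rewrite doubleS height_succ; last by rewrite szE; lia.
by rewrite hodd //; have := hw k kn'; case: (nth false _ _) => /=; lia.
Qed.

Lemma cat_inj_size (T : eqType) (a b c d : seq T) :
  size a = size c -> a ++ b = c ++ d -> a = c /\ b = d.
Proof. by move=> sz /eqP; rewrite eqseq_cat // => /andP[/eqP -> /eqP ->]. Qed.

Lemma cons_ne_inj x y C E : (x != [::]) = (y != [::]) ->
  cons_ne x C = cons_ne y E -> x = y /\ C = E.
Proof. by case: x y => [|a x] [|b y] //= _ [-> -> ->]. Qed.

Lemma runs_determined n (s t : 'S_n) k : 0 < k <= n ->
    ascL 0 s k = ascL 0 t k -> ascR 0 s k = ascR 0 t k -> tot k s = tot k t ->
    runs k (letters 0 s) = runs k (letters 0 t) ->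
  runs k.+1 (letters 0 s) = runs k.+1 (letters 0 t).
Proof.
move=> kn; have k0 : 0 < k by case/andP: kn.
have kN0 : k != 0 by rewrite -lt0n.
have [u [v [ws ku kv]]] := word_split s kn.
have [u' [v' [wt ku' kv']]] := word_split t kn.
have [A [x [y [C [-> -> <- ys [szA _]]]]]] := letters_split k0 ws ku kv kN0.
have [B [x' [y' [E [-> -> <- yt [szB _]]]]]] := letters_split k0 wt ku' kv' kN0.
move=> xx rr tt; have yy : (y != [::]) = (y' != [::]) by rewrite ys yt rr.
have szAB : size A = size B by move: szA; rewrite tt xx -szB => /addIn.
by case/(cat_inj_size szAB) => -> /(cons_ne_inj xx)[-> /(cons_ne_inj yy)[-> ->]].
Qed.

Lemma FV0_raw_inj n : injective (@FV0_raw n).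
Proof.
move=> s t st; case: (posnP n) => [n0|n0].
  by apply/permP => i; have := ltn_ord i; rewrite [X in _ < X]n0.
have data k : 0 < k < n -> [/\ ascL 0 s k = ascL 0 t k,
    ascR 0 s k = ascR 0 t k & tot k s = tot k t].
  case: k => // k /= kn.
  have kn' : 0 < k.+1 < n by [].
  have E1 i : i < n.*2 -> FV0_step s i.+1 = FV0_step t i.+1.
    move=> ilt; have := congr1 (fun q => nth false (tval q.1) i) st.
    by rewrite /FV0_raw !nth_steps.
  have E2 : nth 0 (FV0_raw s).2 k = nth 0 (FV0_raw t).2 k by rewrite st.
  split.
  - have := E1 k.+1.*2; rewrite !FV0_step_odd // => H.
    by apply/negb_inj/H; lia.
  - have := E1 k.*2.+1; rewrite -doubleS !FV0_step_even // => H.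
    by apply: H; lia.
  by move: E2; rewrite !nth_weights ?(ltnW kn) //; case: eqP => //; lia.
have E k : k <= n -> runs k.+1 (letters 0 s) = runs k.+1 (letters 0 t).
  elim: k => [|k IHk] kn; first by rewrite !runs1_letters0.
  have kn' : 0 < k.+1 <= n by [].
  suff [eL eR et] : [/\ ascL 0 s k.+1 = ascL 0 t k.+1,
      ascR 0 s k.+1 = ascR 0 t k.+1 & tot k.+1 s = tot k.+1 t].
    by apply: runs_determined => //; apply: IHk; apply: ltnW.
  have [->|kn1] := eqVneq k.+1 n.
    have [-> /negPf -> ->] := last_value s n0.
    by have [-> /negPf -> ->] := last_value t n0.
  by apply: data; rewrite /= ltn_neqAle kn1.
have := E n (leqnn n); rewrite !runs_top0 => -[].
by move=> /(congr1 (fun w => rev w)); rewrite !rev_rcons => -[] /(can_inj revK) /word_inj.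
Qed.

(* The weighted histories of m pairs of steps, followed by a final down step
   of weight 0, which start at height 2g-1 and end on the axis. *)
Fixpoint histories (m g : nat) : seq (seq bool * seq nat) :=
  if m is m'.+1 then
    let ext a b g' := [seq ([:: a, b & q.1], w :: q.2)
                      | w <- iota 0 g, q <- histories m' g'] in
    ext true true g.+1 ++ ext true false g ++ ext false true g
      ++ ext false false g.-1
  else if g == 1 then [:: ([:: false], [:: 0])] else [::].

Lemma size_histories m g :
  size (histories m g) = if g is g'.+1 then m.+1`! * 'C(m, g') else 0.
Proof.
elim: m g => [|m IHm] g; first by case: g => [|[]].
have -> : size (histories m.+1 g) = g * (size (histories m g.+1) +
    (size (histories m g) + (size (histories m g) + size (histories m g.-1)))).
  by rewrite /= !size_cat !size_allpairs !size_iota -!mulnDr.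
rewrite !IHm; case: g => [|[|g]] /=; rewrite ?mul0n //.
  by rewrite !bin0 bin1 (factS m.+1); move: (m.+1)`! => f; nia.
have -> : m.+1`! * 'C(m, g.+2) + (m.+1`! * 'C(m, g.+1) + (m.+1`! * 'C(m, g.+1) + m.+1`! * 'C(m, g)))
   = m.+1`! * 'C(m.+2, g.+2) by rewrite !binS; lia.
have /= := mul_bin_diag m.+2 g.+1; rewrite (factS m.+1) => H.
by rewrite mulnCA -H; lia.
Qed.

Lemma height_cons a D m :
  height (a :: D) m.+1 = ((if a then 1 else -1) + height D m)%R.
Proof. by rewrite /height /=; case: a => /=; lia. Qed.

Lemma mem_histories m g (D : seq bool) (w : seq nat) :
    size D = m.*2.+1 -> size w = m.+1 ->
    (forall p, p <= m.*2.+1 -> (0 <= 2%:Z * g%:Z - 1 + height D p)%R) ->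
    (2%:Z * g%:Z - 1 + height D m.*2.+1 = 0)%R ->
    (forall i, i <= m ->
      (2%:Z * (nth 0%N w i)%:Z <= 2%:Z * g%:Z - 1 + height D i.*2 - 1)%R) ->
  (D, w) \in histories m g.
Proof.
elim: m g D w => [|m IHm] g D w.
  case: D => [|a []] //; case: w => [|x []] //= _ _ h0 h1 hw.
  have := h0 0 isT; have := hw 0 isT; move: h1.
  rewrite !height_cons !height0 /=; case: a {h0 hw} => h1 h2 h3; first by lia.
  have -> : g = 1 by lia.
  have -> : x = 0 by lia.
  by rewrite inE.
case: D => [|a [|b D]] //; case: w => [|x w] // [szD] [szw] h0 h1 hw.
have hx : x < g by have := hw 0 isT; rewrite height0 /=; lia.
pose g' := if a then (if b then g.+1 else g) else (if b then g else g.-1).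
have gg : ((if a then 1 else -1) + (if b then 1 else -1) + (2%:Z * g%:Z) =
    2%:Z * g'%:Z :> int)%R.
  by rewrite /g'; case: (a); case: (b); lia.
have Dw : (D, w) \in histories m g'.
  apply: IHm => //.
  - move=> p pm; have := h0 p.+2; rewrite !height_cons => H.
    have : p.+2 <= m.+1.*2.+1 by lia.
    by move/H; move: gg; case: (a); case: (b); lia.
  - by move: h1 gg; rewrite doubleS !height_cons; case: (a); case: (b); lia.
  move=> i im; have := hw i.+1; rewrite doubleS !height_cons /= => H.
  have : i.+1 <= m.+1 by [].
  by move/H; move: gg; case: (a); case: (b); lia.
rewrite /histories -/histories !mem_cat.
have ex g1 : g1 = g' -> ([:: a, b & D], x :: w) \in
    [seq ([:: a, b & q.1], z :: q.2) | z <- iota 0 g, q <- histories m g1].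
  move=> ->; apply/allpairsP; exists (x, (D, w)); split=> //=.
  by rewrite mem_iota.
by case: a b @g' {h0 h1 hw szD gg Dw} ex => -[] /= /(_ _ erefl) ->; rewrite ?orbT.
Qed.

Lemma FV0_raw_onto n (p : n.*2.-tuple bool * n.-tuple nat) :
  is_wdyck p -> exists sigma, FV0_raw sigma == p.
Proof.
pose val2 (q : n.*2.-tuple bool * n.-tuple nat) := (tval q.1, tval q.2).
have val2_inj : injective val2.
  by move=> [a b] [c d] [] /val_inj -> /val_inj ->.
case: (posnP n) => [n0 _|n0].
  have nil q : val2 q = ([::], [::]).
    by congr pair; apply: size0nil; rewrite size_tuple n0.
  by exists 1%g; apply/eqP/val2_inj; rewrite !nil.
pose L := [seq (true :: q.1, q.2) | q <- histories n.-1 1].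
have memL q : is_wdyck q -> val2 q \in L.
  case/wdyckP; rewrite /val2; case: q => [[D szD] [w szw]] /=.
  case: D szD => [|a D] szD; first by move: szD => /= /eqP; lia.
  move: szD szw; rewrite /= => /eqP szD /eqP szw hD hn hw.
  have Ea : a = true.
    have := hD 1; rewrite height_cons height0; case: (a) => // H.
    by have : 1 <= n.*2 by [lia]; move/H; lia.
  rewrite Ea in hD hn hw *.
  apply/mapP; exists (D, w) => //; apply: mem_histories; try lia.
  - move=> q qn; have := hD q.+1; rewrite height_cons => H.
    have : q.+1 <= n.*2 by lia.
    by move/H; lia.
  - have Dn : n.*2 = n.-1.*2.+2 by lia.
    by move: hn; rewrite Dn height_cons; lia.
  move=> i im; have := hw i; rewrite height_cons => H.
  have : i < n by lia.
  by move/H; lia.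
pose S := [seq val2 (FV0_raw s) | s <- enum {: 'S_n}].
have uS : uniq S.
  rewrite map_inj_uniq ?enum_uniq // => s t /val2_inj; exact: FV0_raw_inj.
have SL : {subset S <= L}.
  by move=> _ /mapP[s _ ->]; apply: memL; apply: FV0_wdyck.
have szLS : size L <= size S.
  rewrite [size L]size_map [size S]size_map -cardE card_Sn size_histories bin0 muln1.
  by rewrite prednK.
have [_ eqSL] := uniq_min_size uS SL szLS.
move=> /memL; rewrite -eqSL => /mapP[s _ /val2_inj ->].
by exists s.
Qed.

Definition psiFV n (sigma : 'S_n) : wdyck n := exist _ (FV_raw sigma) (FV_wdyck sigma).

Definition psiFV0 n (sigma : 'S_n) : wdyck n :=
  exist _ (FV0_raw sigma) (FV0_wdyck sigma).

Definition psi n (p : wdyck n) : wdyck n :=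
  exist _ (psi_raw (val p)) (psi_wdyck (valP p)).

Lemma psiFV0_onto n (p : wdyck n) : exists sigma, psiFV0 sigma == p.
Proof.
by have [s /eqP Es] := FV0_raw_onto (valP p); exists s; apply/eqP/val_inj.
Qed.

Definition psiFV0_inv n (p : wdyck n) : 'S_n := xchoose (psiFV0_onto p).

Lemma psiFV0_invK n : cancel (@psiFV0_inv n) (@psiFV0 n).
Proof. by move=> p; apply/eqP; apply: (xchooseP (psiFV0_onto p)). Qed.

Lemma psiFV0K n : cancel (@psiFV0 n) (@psiFV0_inv n).
Proof.
by move=> s; have := psiFV0_invK (psiFV0 s) => /(congr1 val) /FV0_raw_inj.
Qed.

Definition Psi n (sigma : 'S_n) : 'S_n := psiFV0_inv (psi (psiFV sigma)).

(* Main.v *)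
Require Import Defs.
From mathcomp Require Import all_boot all_order all_algebra all_fingroup.
From mathcomp Require Import zify.

Set Implicit Arguments.
Unset Strict Implicit.
Unset Printing Implicit Defensive.

(* Let m_k(sigma) be the largest value smaller than k to the left of k (0 if
   there is none). These numbers determine BST(sigma): the root of an interval
   I is the largest k in I such that m_k is below I. The maximum of the first
   i+1 runs of letters < k only depends on i, on the numbers tot_j and on the
   booleans ascL_j for j < k: whether j is glued to the run on its right changes
   the number of runs but no prefix maximum. As sigma and Psi(sigma) share all
   tot_j and ascL_j, and m_k is the maximum of the first tot_k + 1 runs, they
   have the same m_k. *)

Definition lower_max (w : seq nat) (k : nat) : nat :=
  \max_(x <- take (index k w) w | x < k) x.

Lemma lower_max_cat u k v : k \notin u ->
  lower_max (u ++ k :: v) k = \max_(x <- u | x < k) x.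
Proof.
by move=> ku; rewrite /lower_max index_pivot // take_size_cat.
Qed.

Lemma filter_consP (T : eqType) (a : pred T) s k r :
  filter a s = k :: r ->
  exists u v, [/\ s = u ++ k :: v, a k & all (predC a) u].
Proof.
elim: s => //= x s IHs; case: ifP => ax.
  by case=> <- _; exists [::], s.
by move=> /IHs[u [v [-> ak au]]]; exists (x :: u), v; rewrite /= ax.
Qed.

Definition convex (I : seq nat) :=
  forall x y z, x \in I -> z \in I -> x <= y <= z -> y \in I.

Lemma convex_filter_lt k I : convex I -> convex [seq x <- I | x < k].
Proof.
move=> cI x y z; rewrite !mem_filter => /andP[xk xI] /andP[zk zI] xyz.
by rewrite (cI x y z) // andbT; lia.
Qed.

Lemma convex_filter_gt k I : convex I -> convex [seq x <- I | k < x].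
Proof.
move=> cI x y z; rewrite !mem_filter => /andP[kx xI] /andP[kz zI] xyz.
by rewrite (cI x y z) // andbT; lia.
Qed.

(** If [k < k'], then [k] precedes [k'] in [s], so [lower_max s k' >= k]. In [t] no letter of [I]
    precedes [k'], so by convexity [lower_max t k' < k], a contradiction. *)
Lemma first_in_leq s t I k k' r r' : s =i t -> all (leq 1) s ->
  {in s, lower_max s =1 lower_max t} -> convex I ->
  [seq x <- s | x \in I] = k :: r -> [seq x <- t | x \in I] = k' :: r' ->
  k' <= k.
Proof.
move=> st s0 mst cI /filter_consP[u [v [Es kI uI]]] /filter_consP[u' [v' [Et kI' uI']]].
rewrite leqNgt; apply/negP => kk'.
have k0 : 0 < k by apply: (allP s0); rewrite Es mem_cat mem_head orbT.
have k's : k' \in s by rewrite st Et mem_cat mem_head orbT.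
have k'u : k' \notin u by apply: contraL kI' => /(allP uI).
have k'u' : k' \notin u' by apply: contraL kI' => /(allP uI').
have := mst _ k's; rewrite [in RHS]Et lower_max_cat //.
(* A letter of [u'] in [[k, k')] would lie in [I]. As [k > 0], the bound [k.-1] is strictly below
   [k], also for an empty maximum. *)
have lt : \max_(x <- u' | x < k') x <= k.-1.
  apply/bigmax_leqP_seq => x xu' xk'; suff : ~~ (k <= x) by lia.
  by apply: contra (allP uI' _ xu') => kx; apply: cI kI kI' _; rewrite kx ltnW.
suff : k <= lower_max s k' by lia.
apply: (@leq_bigmax_seq _ _ (fun x => x < k') id) => //.
rewrite Es index_cat (negPf k'u) take_cat ltnNge leq_addr /= addKn.
by rewrite eq_sym gtn_eqF //= mem_cat mem_head orbT.
Qed.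

(** Using [first_in_leq] in both directions makes the roots equal, and both subintervals stay
    convex. *)
Lemma bst_rec_lower_max f s t I : s =i t -> all (leq 1) s ->
  {in s, lower_max s =1 lower_max t} -> convex I ->
  bst_rec f s I = bst_rec f t I.
Proof.
move=> st s0 mst; elim: f I => //= f IHf I cI.
have t0 : all (leq 1) t by apply/allP => x; rewrite -st; apply: (allP s0).
have mts : {in t, lower_max t =1 lower_max s}.
  by move=> x; rewrite -st => xs; rewrite mst.
case Es: [seq x <- s | x \in I] => [|k r]; case Et: [seq x <- t | x \in I] => [|k' r'] //.
- have : k' \in [seq x <- t | x \in I] by rewrite Et mem_head.
  by rewrite mem_filter -st -mem_filter Es.
- have : k \in [seq x <- s | x \in I] by rewrite Es mem_head.
  by rewrite mem_filter st -mem_filter Et.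
have -> : k = k'.
  apply/eqP; rewrite eqn_leq (first_in_leq _ t0 mts cI Et Es) //.
  by rewrite (first_in_leq st s0 mst cI Es Et).
by rewrite !IHf //; [apply: convex_filter_gt | apply: convex_filter_lt].
Qed.

(** Run [i] is included, so that [i = tot k sigma] covers exactly the runs left of [k]. *)
Definition prefix_max (R : seq (seq nat)) (i : nat) : nat :=
  \max_(x <- flatten (take i.+1 R)) x.

Lemma flatten_runs k s : flatten (runs k s) = [seq x <- s | x < k].
Proof.
elim: s => //= x s <-; rewrite runs_cons /runs.
by case: split_runs => -[|a y] C; case: ifP.
Qed.

Section Letters.
Variables (n e : nat) (sigma : 'S_n) (k : nat).
Hypotheses (kn : 0 < k <= n) (ke : k != e).

(** Raising the threshold merges [k] and its adjacent runs into the run of index [size A]. Earlier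
    runs are unchanged, and from there on every prefix contains [k], the largest letter allowed. *)
Lemma prefix_max_runs_succ i : prefix_max (runs k.+1 (letters e sigma)) i =
  if i + ascL e sigma k < (tot k sigma).+1
  then prefix_max (runs k (letters e sigma)) i else k.
Proof.
have k0 : 0 < k by case/andP: kn.
have [u [v [Ew ku kv]]] := word_split sigma kn.
have [A [x [y [C [Ek Ek1 <- _ [<- _]]]]]] := letters_split k0 Ew ku kv ke.
have fl := flatten_runs k.+1 (letters e sigma).
(* Both sides of the test now carry the summand [x != [::]]; once it is cancelled, the test is
   [i < size A]. *)
rewrite ltn_add2r /prefix_max; case: ltnP => [iA|Ai].
  by rewrite Ek Ek1 !takel_cat.
apply/eqP; rewrite eqn_leq; apply/andP; split.
  apply/bigmax_leqP_seq => z zR _.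
  have : z \in flatten (runs k.+1 (letters e sigma)).
    by rewrite -(cat_take_drop i.+1 (runs _ _)) flatten_cat mem_cat zR.
  by rewrite fl mem_filter ltnS => /andP[].
apply: (@leq_bigmax_seq _ _ xpredT id) => //.
rewrite Ek1 take_cat ltnNge (leqW Ai) /= subSn //=.
by rewrite flatten_cat /= !mem_cat in_cons eqxx !orbT.
Qed.

(** A run left of [k] starts at the initial [0] or at a descent passing over [k], which makes
    [tot k sigma + 1] runs. *)
Lemma prefix_max_tot :
  prefix_max (runs k (letters e sigma)) (tot k sigma) = lower_max (word sigma) k.
Proof.
have k0 : 0 < k by case/andP: kn.
have [u [v [Ew ku kv]]] := word_split sigma kn.
rewrite /prefix_max (lettersE e Ew) runs_cat // take_size_cat; last first.
  by rewrite size_runs ?k_notin_0u // k0 addn1 (totE k0 Ew ku kv ke).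
rewrite flatten_runs big_filter Ew lower_max_cat // big_cons k0.
exact: max0n.
Qed.
End Letters.

(** The number of runs depends on [e], but only the letter [0] is below [1]. *)
Lemma prefix_max_runs1 n e (sigma : 'S_n) i : 0 < n ->
  prefix_max (runs 1 (letters e sigma)) i = 0.
Proof.
move=> n0; apply/eqP; rewrite -leqn0; apply/bigmax_leqP_seq => x xR _.
have : x \in flatten (runs 1 (letters e sigma)).
  by rewrite -(cat_take_drop i.+1 (runs _ _)) flatten_cat mem_cat xR.
by rewrite flatten_runs mem_filter ltnS => /andP[].
Qed.

Lemma FV0_Psi n (sigma : 'S_n) : FV0_raw (Psi sigma) = psi_raw (FV_raw sigma).
Proof. by have /(congr1 val) := psiFV0_invK (psi (psiFV sigma)). Qed.

(** Swapping unequal steps at positions [2k], [2k+1] always brings the old step [2k] to position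
    [2k+1]. These are the places where [FV_step] and [FV0_step] store [~~ ascL] of [k]. *)
Lemma ascL_Psi n (sigma : 'S_n) k : 0 < k < n ->
  ascL 0 (Psi sigma) k = ascL n.+1 sigma k.
Proof.
move=> kn; apply: negb_inj; rewrite -FV0_step_odd //.
have k2 : k.*2 < n.*2 by lia.
have := congr1 (fun q => nth false (tval q.1) k.*2) (FV0_Psi sigma).
rewrite !nth_steps // => ->.
have -> : ~~ ascL n.+1 sigma k = entry false (FV_raw sigma).1 k.*2.
  rewrite /entry nth_steps; last lia.
  by rewrite prednK ?double_gt0; [rewrite /FV_step odd_double doubleK | lia].
rewrite /psi_step /= uphalf_double.
have -> : (1 < k.*2.+1 < n.*2) = true by lia.
by case: (entry _ _ k.*2); case: (entry _ _ k.*2.+1).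
Qed.

Lemma tot_Psi n (sigma : 'S_n) k : 0 < k <= n ->
  tot k (Psi sigma) = tot k sigma.
Proof.
move=> /andP[k0 kn]; have n0 : 0 < n := leq_trans k0 kn.
(* The last weight of [FV0_raw] is [0] by convention and carries no information, but [tot n]
   vanishes for every permutation. *)
have [->|kn'] := eqVneq k n.
  by have [_ _ ->] := last_value (Psi sigma) n0; have [_ _ ->] := last_value sigma n0.
have := congr1 (fun q => nth 0 (tval q.2) k.-1) (FV0_Psi sigma).
by rewrite !nth_weights ?prednK // (negPf kn').
Qed.

(** The recurrence in [k] involves only values [j < k <= n], which is the range where [ascL_Psi]
    applies. *)
Lemma prefix_max_Psi n (sigma : 'S_n) k i : 0 < k <= n ->
  prefix_max (runs k (letters 0 (Psi sigma))) i =
  prefix_max (runs k (letters n.+1 sigma)) i.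
Proof.
elim: k => // -[|k] IHk kn; first by rewrite !prefix_max_runs1.
have kn' : 0 < k.+1 <= n by lia.
rewrite !(@prefix_max_runs_succ _ _ _ k.+1) //; last lia.
by rewrite IHk // ascL_Psi // tot_Psi.
Qed.

Lemma lower_max_Psi n (sigma : 'S_n) k : 0 < k <= n ->
  lower_max (word sigma) k = lower_max (word (Psi sigma)) k.
Proof.
move=> kn; rewrite -(@prefix_max_tot _ n.+1) //; last lia.
rewrite -(@prefix_max_tot _ 0) //; last lia.
by rewrite prefix_max_Psi // tot_Psi.
Qed.

Theorem theorem6p10 (n : nat) (hn : 1 <= n) (sigma : 'S_n) :
  BST sigma = BST (Psi sigma).
Proof.
apply: bst_rec_lower_max => [k||k|x y z].
- by rewrite !mem_word.
- exact: word_gt0.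
- by rewrite mem_word; apply: lower_max_Psi.
- by rewrite !mem_iota; lia.
Qed.
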